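(* Let $L\in\mathbb{R}^{m\times n}$, let $\Gamma\in\mathbb{R}^{n\times n}$ and $C\in\mathbb{R}^{m\times m}$ be symmetric positive definite, let ${\bf y}\in\mathbb{R}^m$ be non-zero, and assume that all columns of $L\Gamma^{1/2}$ are non-zero. Let $$\hat{\mathcal{S}}({\bf y})=\left\{k\in\{1,\dots,n\}:\ \mathrm{proj}_{\bf y}\left([L\Gamma^{1/2}]_k\mid C\right)=1\right\},$$ let $\hat K$ be the matrix whose columns are $[L\Gamma^{1/2}]_k$, $k\in\hat{\mathcal{S}}({\bf y})$, and let $\hat H$ be the matrix whose columns are $[L\Gamma^{1/2}]_k$, $k\in\{1,\dots,n\}\setminus\hat{\mathcal{S}}({\bf y})$. Put $A=[\hat K\ \hat H]\in\mathbb{R}^{m\times n}$, with columns ${\bf A}_1,\dots,{\bf A}_n$, and $$\hat T=\mathrm{Diag}\left(A^{\mathrm T}\left(AA^{\mathrm T}+C\right)^{-1}A\right)^{1/2}.$$ Let ${\bf z}=(z_1,\dots,z_n)^{\mathrm T}$ be the solution of the standardized minimum norm problem $$\min_{{\bf z}\in\mathbb{R}^n}\left\{\rho\left({\bf y},A\hat T{\bf z}\mid C\right)^2+\rho\left({\bf 0},\hat T{\bf z}\mid I\right)^2\right\}.$$ Suppose there exists a particular solution ${\bf v}_0$ of $\hat K{\bf v}_0={\bf y}$. Then the maximum components of the reconstruction vector ${\bf z}$ correspond to the system matrix columns that can be written as $\hat K{\bf v}$ with ${\bf v}\in\mathrm{span}({\bf v}_0)$; that is, for every $i\in\{1,\dots,n\}$,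 one has $|z_i|=\max_{1\le j\le n}|z_j|$ if and only if ${\bf A}_i=\hat K{\bf v}$ for some ${\bf v}\in\mathrm{span}({\bf v}_0)$.
   Context: For a matrix $B$, $[B]_k$ denotes its $k$th column. $\Gamma^{1/2}$ is the symmetric positive definite square root of $\Gamma$. For a square matrix $B$, $\mathrm{Diag}(B)$ is the diagonal matrix with the same diagonal entries as $B$. The Mahalanobis distance is $\rho({\bf u},{\bf v}\mid\Sigma)=\sqrt{({\bf u}-{\bf v})^{\mathrm T}\Sigma^{-1}({\bf u}-{\bf v})}$ for $\Sigma$ symmetric positive definite. The normalized scalar projection of a non-zero vector ${\bf w}\in\mathbb{R}^m$ onto a non-zero vector ${\bf y}\in\mathbb{R}^m$ is $$\mathrm{proj}_{\bf y}({\bf w}\mid C)=\frac{{\bf y}^{\mathrm T}C^{-1}{\bf w}}{\sqrt{{\bf y}^{\mathrm T}C^{-1}{\bf y}\;{\bf w}^{\mathrm T}C^{-1}{\bf w}}}.$$ The columns of $L\Gamma^{1/2}$ are thus reordered so that those indexed by $\hat{\mathcal{S}}({\bf y})$ come first, and the components of ${\bf z}$ are indexed in the same order as the columns of $A$. The paper's localization convention takes the component of the reconstruction with the largest magnitude as the estimated source location. *)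

(* Defs.v *)
From HB Require Import structures.
From mathcomp Require Import all_boot all_order all_algebra.
From mathcomp Require Import boolp classical_sets reals.

Set Implicit Arguments.
Unset Strict Implicit.
Unset Printing Implicit Defensive.

Import Order.TTheory GRing.Theory Num.Theory.
Local Open Scope ring_scope.

Definition posdefmx (R : realType) (n : nat) (B : 'M[R]_n) : Prop :=
  B^T = B /\ forall x : 'cV[R]_n, x != 0 -> 0 < (x^T *m B *m x) 0 0.

(* A symmetric positive definite [B] has exactly one symmetric positive
   definite square root, and [sqrtmx B] is that matrix; the default value 0 is
   only returned for a [B] which has no such root. *)
Definition sqrtmx (R : realType) (n : nat) (B : 'M[R]_n) : 'M[R]_n :=
  xget 0 (fun S : 'M[R]_n => posdefmx S /\ S *m S = B).

Definition Diag (R : realType) (n : nat) (B : 'M[R]_n) : 'M[R]_n :=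
  diag_mx (\row_i B i i).

Definition mahalanobis (R : realType) (m : nat) (u v : 'cV[R]_m)
    (Sigma : 'M[R]_m) : R :=
  Num.sqrt (((u - v)^T *m invmx Sigma *m (u - v)) 0 0).

Definition proj (R : realType) (m : nat) (y w : 'cV[R]_m) (C : 'M[R]_m) : R :=
  (y^T *m invmx C *m w) 0 0
  / Num.sqrt ((y^T *m invmx C *m y) 0 0 * (w^T *m invmx C *m w) 0 0).

(* The columns of [B] indexed by [S], in increasing order of their indices. *)
Definition cols_in (R : realType) (m n : nat) (S : {set 'I_n})
    (B : 'M[R]_(m, n)) : 'M[R]_(m, #|S|) :=
  colsub (fun j : 'I_#|S| => enum_val j) B.

Lemma card_setC_ord (n : nat) (S : {set 'I_n}) : (#|S| + #|(~: S)%SET| = n)%N.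
Proof. by rewrite cardsC card_ord. Qed.

Definition Shat (R : realType) (m n : nat) (B : 'M[R]_(m, n)) (C : 'M[R]_m)
    (y : 'cV[R]_m) : {set 'I_n} :=
  [set k | proj y (col k B) C == 1]%SET.

(* The cast only replaces the width [#|S| + #|~: S|] of the block matrix by the
   equal number [n]. *)
Definition reorder_cols (R : realType) (m n : nat) (S : {set 'I_n})
    (B : 'M[R]_(m, n)) : 'M[R]_(m, n) :=
  castmx (erefl m, card_setC_ord S)
    (row_mx (cols_in S B) (cols_in (~: S)%SET B)).

(* Main.v *)
(** The standardized minimum norm solution is
    [z = That^-1 A^T M^-1 y] with [M = A A^T + C], so that
    [z_i = (A_i^T M^-1 y) / sqrt (A_i^T M^-1 A_i)].  By the Cauchy-Schwarz
    inequality for [M^-1], [z_i ^ 2 <= y^T M^-1 y], with equality exactly when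
    [A_i] is a multiple of [y].  The bound is attained: since [Khat v0 = y] is
    non-zero, [Shat] is non-empty, and its columns are multiples of [y] by the
    equality case of Cauchy-Schwarz for [C^-1]. *)
Require Import Defs.
From HB Require Import structures.
From mathcomp Require Import all_boot all_order all_algebra.
From mathcomp Require Import boolp classical_sets reals.
From mathcomp Require Import ring lra.

Set Implicit Arguments.
Unset Strict Implicit.
Unset Printing Implicit Defensive.

Import Order.TTheory GRing.Theory Num.Theory.
Local Open Scope ring_scope.

(** * Bilinear form of a matrix *)

Definition bform (R : realType) (n : nat) (M : 'M[R]_n) (u v : 'cV[R]_n) : R :=
  (u^T *m M *m v) 0 0.

Lemma bformDl (R : realType) (n : nat) (M : 'M[R]_n) (u1 u2 v : 'cV[R]_n) :
  bform M (u1 + u2) v = bform M u1 v + bform M u2 v.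
Proof. by rewrite /bform linearD /= !mulmxDl mxE. Qed.

Lemma bformDr (R : realType) (n : nat) (M : 'M[R]_n) (u v1 v2 : 'cV[R]_n) :
  bform M u (v1 + v2) = bform M u v1 + bform M u v2.
Proof. by rewrite /bform mulmxDr mxE. Qed.

Lemma bformZl (R : realType) (n : nat) (M : 'M[R]_n) (a : R)
    (u v : 'cV[R]_n) :
  bform M (a *: u) v = a * bform M u v.
Proof. by rewrite /bform linearZ /= -!scalemxAl mxE. Qed.

Lemma bformZr (R : realType) (n : nat) (M : 'M[R]_n) (a : R)
    (u v : 'cV[R]_n) :
  bform M u (a *: v) = a * bform M u v.
Proof. by rewrite /bform -scalemxAr mxE. Qed.

Lemma bform_sym (R : realType) (n : nat) (M : 'M[R]_n) (u v : 'cV[R]_n) :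
  M^T = M -> bform M u v = bform M v u.
Proof.
move=> sM; have tr11 (X : 'M[R]_1) : X^T 0 0 = X 0 0 by rewrite mxE.
by rewrite /bform -[LHS]tr11 !trmx_mul trmxK sM mulmxA.
Qed.

Lemma col_mulmx (R : realType) (m n p : nat) (A : 'M[R]_(m, n))
    (B : 'M[R]_(n, p)) (j : 'I_p) :
  col j (A *m B) = A *m col j B.
Proof. by rewrite !colE mulmxA. Qed.

Lemma bform_col_l (R : realType) (m n : nat) (M : 'M[R]_m)
    (A : 'M[R]_(m, n)) (v : 'cV[R]_m) (i : 'I_n) :
  (A^T *m M *m v) i 0 = bform M (col i A) v.
Proof. by rewrite /bform tr_col -!row_mul [RHS]mxE. Qed.

Lemma bform_col (R : realType) (m n : nat) (M : 'M[R]_m)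
    (A : 'M[R]_(m, n)) (i j : 'I_n) :
  (A^T *m M *m A) i j = bform M (col i A) (col j A).
Proof. by rewrite -bform_col_l -col_mulmx [RHS]mxE. Qed.

(** * Positive definite forms and Cauchy-Schwarz *)

Lemma posdef_bform_gt0 (R : realType) (n : nat) (M : 'M[R]_n) (u : 'cV[R]_n) :
  posdefmx M -> u != 0 -> 0 < bform M u u.
Proof. by case=> _; apply. Qed.

Lemma posdef_bform_ge0 (R : realType) (n : nat) (M : 'M[R]_n) (u : 'cV[R]_n) :
  posdefmx M -> 0 <= bform M u u.
Proof.
move=> pM; have [->|/(posdef_bform_gt0 pM)/ltW //] := eqVneq u 0.
by rewrite /bform mulmx0 mxE.
Qed.

Lemma posdef_bform_eq0 (R : realType) (n : nat) (M : 'M[R]_n) (u : 'cV[R]_n) :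
  posdefmx M -> bform M u u <= 0 -> u = 0.
Proof.
move=> pM u_le0; apply/eqP/negPn/negP=> /(posdef_bform_gt0 pM).
by rewrite ltNge u_le0.
Qed.

Lemma CauchySchwarz_bform (R : realType) (n : nat) (M : 'M[R]_n)
    (u v : 'cV[R]_n) : posdefmx M ->
  bform M u v ^+ 2 <= bform M u u * bform M v v.
Proof.
move=> pM; have [->|v0] := eqVneq v 0.
  by rewrite /bform !mulmx0 mxE mulr0 expr0n.
have vv := posdef_bform_gt0 pM v0.
(* This vector is [bform M v v] times the component of [u] that is [M]-orthogonal to [v]; its form
   value is [bform M v v] times the Cauchy-Schwarz defect. *)
have := posdef_bform_ge0 (bform M v v *: u + (- bform M u v) *: v) pM.
rewrite !(bformDl, bformDr, bformZl, bformZr) (bform_sym v u pM.1) => h.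
rewrite -subr_ge0 -(pmulr_rge0 _ vv); apply: le_trans h _.
by rewrite le_eqVlt; apply/orP; left; apply/eqP; ring.
Qed.

Lemma CauchySchwarz_bform_eq (R : realType) (n : nat) (M : 'M[R]_n)
    (u v : 'cV[R]_n) : posdefmx M -> v != 0 ->
  bform M u v ^+ 2 = bform M u u * bform M v v <-> exists c, u = c *: v.
Proof.
move=> pM v0; split=> [e|[c ->]]; last by rewrite !(bformZl, bformZr); ring.
have vv := posdef_bform_gt0 pM v0.
(* The coefficient of the [M]-orthogonal projection of [u] onto [v]: under equality the residual has
   form value 0, so definiteness kills it. *)
exists (bform M u v / bform M v v); apply/eqP; rewrite -subr_eq0 -scaleNr.
apply/eqP/(posdef_bform_eq0 pM); rewrite le_eqVlt; apply/orP; left; apply/eqP.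
rewrite !(bformDl, bformDr, bformZl, bformZr) (bform_sym v u pM.1).
have -> : bform M u u = bform M u v ^+ 2 / bform M v v.
  by rewrite e mulfK // gt_eqF.
by field; rewrite gt_eqF.
Qed.

(** * Positive definite matrices and their square roots *)

Lemma posdef_unitmx (R : realType) (n : nat) (M : 'M[R]_n) :
  posdefmx M -> M \in unitmx.
Proof.
move=> pM; rewrite -row_free_unit -kermx_eq0.
(* A row of the left kernel of [M], transposed, has form value 0. *)
apply/eqP/row_matrixP=> i; rewrite row0.
apply: trmx_inj; rewrite trmx0; apply: (posdef_bform_eq0 pM).
by rewrite /bform trmxK -row_mul mulmx_ker row0 mul0mx mxE.
Qed.

Lemma posdef_invmx (R : realType) (n : nat) (M : 'M[R]_n) :
  posdefmx M -> posdefmx (invmx M).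
Proof.
move=> pM; have uM := posdef_unitmx pM; split; first by rewrite trmx_inv pM.1.
move=> x x0; have := @posdef_bform_gt0 _ _ M (invmx M *m x) pM.
rewrite /bform trmx_mul trmx_inv pM.1 mulmxKV // mulmxA.
by apply; apply: contra_neq x0 => e; rewrite -(mulKVmx uM x) e mulmx0.
Qed.

Lemma bform1_ge0 (R : realType) (n : nat) (u : 'cV[R]_n) : 0 <= bform 1%:M u u.
Proof.
rewrite /bform mulmx1 mxE; apply: sumr_ge0 => i _.
by rewrite mxE -expr2 sqr_ge0.
Qed.

Lemma posdef1 (R : realType) (n : nat) : posdefmx (1%:M : 'M[R]_n).
Proof.
split=> [|x x0]; first exact: trmx1.
rewrite lt_def bform1_ge0 andbT mulmx1 mxE; apply: contra_neq x0 => e.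
apply/matrixP=> i j; rewrite ord1 [RHS]mxE; apply/eqP; rewrite -sqrf_eq0.
move/eqP: e; rewrite psumr_eq0 => [/allP/(_ i)|k _].
  by rewrite mem_index_enum mxE -expr2 => /(_ isT).
by rewrite mxE -expr2 sqr_ge0.
Qed.

Lemma posdef_gram_add (R : realType) (m n : nat) (A : 'M[R]_(m, n))
    (C : 'M[R]_m) : posdefmx C -> posdefmx (A *m A^T + C).
Proof.
move=> pC; split; first by rewrite linearD /= trmx_mul trmxK pC.1.
move=> x /(posdef_bform_gt0 pC); rewrite /bform => x_gt0.
rewrite mulmxDr mulmxDl mxE ltr_wpDl //.
have := bform1_ge0 (A^T *m x).
by rewrite /bform mulmx1 trmx_mul trmxK !mulmxA.
Qed.

Lemma posdef_diag (R : realType) (n : nat) (d : 'rV[R]_n) :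
  (forall i, 0 < d 0 i) -> posdefmx (diag_mx d).
Proof.
move=> d_gt0; split=> [|x x0]; first exact: tr_diag_mx.
have e : (x^T *m diag_mx d *m x) 0 0 = \sum_i d 0 i * x i 0 ^+ 2.
  rewrite mxE; apply: eq_bigr => i _.
  by rewrite mul_mx_diag !mxE; ring.
rewrite e lt_def sumr_ge0 ?andbT; last first.
  by move=> i _; rewrite mulr_ge0 ?sqr_ge0 // ltW.
apply: contra_neq x0 => s0; apply/matrixP=> i j; rewrite ord1 [RHS]mxE.
apply/eqP; rewrite -sqrf_eq0.
move/eqP: s0; rewrite psumr_eq0 => [/allP/(_ i)|k _].
  by rewrite mem_index_enum mulf_eq0 gt_eqF //= => /(_ isT).
by rewrite mulr_ge0 ?sqr_ge0 // ltW.
Qed.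

(** Since [sqrtmx] picks some positive definite root, computing it requires uniqueness of that
    root. *)
Lemma sqrtmx_diag (R : realType) (n : nat) (d : 'rV[R]_n) :
  (forall i, 0 < d 0 i) ->
  sqrtmx (diag_mx d) = diag_mx (\row_i Num.sqrt (d 0 i)).
Proof.
move=> d_gt0; set t := \row_i _.
have t_gt0 i : 0 < t 0 i by rewrite mxE sqrtr_gt0.
have tt : diag_mx t *m diag_mx t = diag_mx d.
  rewrite mulmx_diag; congr diag_mx; apply/rowP=> i; rewrite !mxE.
  by rewrite -expr2 sqr_sqrtr // ltW.
have [pS SS] : posdefmx (sqrtmx (diag_mx d)) /\
    sqrtmx (diag_mx d) *m sqrtmx (diag_mx d) = diag_mx d.
  (* The default value 0 is excluded because [diag_mx t] is a root. *)
  rewrite /sqrtmx; case: xgetP => [S -> //|/(_ (diag_mx t))].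
  by case; split=> //; exact: posdef_diag.
move: (sqrtmx _) pS SS => S pS SS.
(* [X := S - diag_mx t] satisfies [S X = - X diag_mx t], so its [j]th column
   would be an eigenvector of [S] for the negative eigenvalue [- t_j]. *)
apply/eqP; rewrite -subr_eq0; apply/eqP; set X := S - _.
have SX : S *m X = - (X *m diag_mx t).
  by rewrite /X mulmxBr mulmxBl SS tt opprB.
apply/matrixP=> i j; rewrite [RHS]mxE.
suff /matrixP/(_ i 0) : col j X = 0 by rewrite !mxE.
apply: (posdef_bform_eq0 pS); rewrite /bform -mulmxA -col_mulmx SX.
have -> : col j (- (X *m diag_mx t)) = (- t 0 j) *: col j X.
  by apply/colP=> k; rewrite mul_mx_diag !mxE mulNr mulrC.
rewrite -scalemxAr mxE mulNr oppr_le0 mulr_ge0 ?(ltW (t_gt0 j)) //.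
by have := bform1_ge0 (col j X); rewrite /bform mulmx1.
Qed.

(** * The regularized least squares problem *)

Lemma mahalanobis_sqr (R : realType) (m : nat) (u v : 'cV[R]_m)
    (C : 'M[R]_m) : posdefmx C ->
  mahalanobis u v C ^+ 2 = bform (invmx C) (u - v) (u - v).
Proof.
move=> pC; rewrite /mahalanobis sqr_sqrtr //.
exact/posdef_bform_ge0/posdef_invmx.
Qed.

(** The standardized objective in the variable [x = That *m z], which removes [That] from the
    minimization. *)
Definition tikhonov (R : realType) (m n : nat) (A : 'M[R]_(m, n))
    (C : 'M[R]_m) (y : 'cV[R]_m) (x : 'cV[R]_n) : R :=
  bform (invmx C) (y - A *m x) (y - A *m x) + bform 1%:M x x.

(* With [e = M^-1 y] and [x0 = A^T e], the residual [y - A x0] is [C e], so the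
   terms linear in [h] cancel and the functional at [x0 + h] exceeds the one at
   [x0] by [(A h)^T C^-1 (A h) + h^T h]. *)
Lemma tikhonov_min (R : realType) (m n : nat) (A : 'M[R]_(m, n))
    (C : 'M[R]_m) (y : 'cV[R]_m) (x : 'cV[R]_n) :
  posdefmx C ->
  (forall x', tikhonov A C y x <= tikhonov A C y x') ->
  x = A^T *m invmx (A *m A^T + C) *m y.
Proof.
move=> pC; have uC := posdef_unitmx pC.
have uM := posdef_unitmx (posdef_gram_add A pC).
rewrite -mulmxA; set e := invmx _ *m y; set x0 := A^T *m e => /(_ x0).
have ye : y - A *m x0 = C *m e.
  by rewrite -{1}(mulKVmx uM y) -/e mulmxDl -mulmxA addrAC subrr add0r.
rewrite -(subrK x0 x) (addrC (x - x0)); move: (x - x0) => h.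
rewrite /tikhonov mulmxDr opprD addrA ye -mulmxN.
have pC' := posdef_invmx pC; have p1 := posdef1 R n.
have cross : bform (invmx C) (C *m e) (A *m h) = bform 1%:M x0 h.
  by rewrite /bform /x0 !trmx_mul trmxK pC.1 (mulmxK uC) mulmx1 mulmxA.
have -> : A *m - h = (-1) *: (A *m h) by rewrite mulmxN scaleN1r.
rewrite !(bformDl, bformDr, bformZl, bformZr).
rewrite (bform_sym (A *m h) _ pC'.1) (bform_sym h _ p1.1) cross.
have ge0 := posdef_bform_ge0 (A *m h) pC' => le0.
by rewrite (@posdef_bform_eq0 _ _ _ h p1) ?addr0 //; lra.
Qed.

(** * Columns of the reordered matrix and the selected index set *)

Lemma col_reorder_cols (R : realType) (m n : nat) (S : {set 'I_n})
    (B : 'M[R]_(m, n)) (i : 'I_n) :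
  exists k, col i (reorder_cols S B) = col k B.
Proof.
case: (split_ordP (cast_ord (esym (card_setC_ord S)) i)) => j ij;
  exists (enum_val j); apply/colP=> r;
  by rewrite !mxE castmxE cast_ord_id ij ?row_mxEl ?row_mxEr !mxE.
Qed.

Lemma col_reorder_cols_in (R : realType) (m n : nat) (S : {set 'I_n})
    (B : 'M[R]_(m, n)) (k : 'I_n) :
  k \in S -> exists i, col i (reorder_cols S B) = col k B.
Proof.
move=> kS; exists (cast_ord (card_setC_ord S) (lshift _ (enum_rank_in kS k))).
apply/colP=> r; rewrite !mxE castmxE cast_ord_id cast_ordK row_mxEl !mxE.
by rewrite enum_rankK_in.
Qed.

Lemma cols_in_mul_neq0 (R : realType) (m n : nat) (S : {set 'I_n})
    (B : 'M[R]_(m, n)) (v : 'cV[R]_#|S|) :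
  cols_in S B *m v != 0 -> exists k, k \in S.
Proof.
move=> Bv; have [S0|[k kS]] := set_0Vmem S; last by exists k.
case/eqP: Bv; apply/colP=> i; rewrite !mxE big1 // => j _.
by have := enum_valP j; rewrite {2}S0 inE.
Qed.

Lemma proj_eq1_collinear (R : realType) (m : nat) (y w : 'cV[R]_m)
    (C : 'M[R]_m) : posdefmx C -> y != 0 -> w != 0 ->
  proj y w C = 1 -> exists c, w = c *: y.
Proof.
move=> /posdef_invmx pC y0 w0; rewrite /proj -!/(bform _ _ _) => e.
have yy := posdef_bform_gt0 pC y0; have ww := posdef_bform_gt0 pC w0.
apply/(CauchySchwarz_bform_eq w pC y0).
have s0 : Num.sqrt (bform (invmx C) y y * bform (invmx C) w w) != 0.
  by rewrite gt_eqF // sqrtr_gt0 mulr_gt0.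
(* A quotient equal to 1 makes the numerator equal to the square root; squaring gives equality in
   Cauchy-Schwarz. *)
rewrite (bform_sym w y pC.1) (divr1_eq e).
by rewrite sqr_sqrtr ?mulr_ge0 1?mulrC // ltW.
Qed.

Theorem theorem4p1 (R : realType) (m n : nat)
    (L : 'M[R]_(m, n)) (Gamma : 'M[R]_n) (C : 'M[R]_m) (y : 'cV[R]_m)
    (hGamma : posdefmx Gamma) (hC : posdefmx C) (hy : y != 0)
    (hcols : forall k : 'I_n, col k (L *m sqrtmx Gamma) != 0) :
  let B := L *m sqrtmx Gamma in
  let S := Shat B C y in
  let Khat := cols_in S B in
  let A := reorder_cols S B in
  let That := sqrtmx (Diag (A^T *m invmx (A *m A^T + C) *m A)) in
  let J := fun z : 'cV[R]_n =>
    mahalanobis y (A *m That *m z) C ^+ 2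
    + mahalanobis 0 (That *m z) 1%:M ^+ 2 in
  forall z : 'cV[R]_n, (forall z' : 'cV[R]_n, J z <= J z') ->
  forall v0 : 'cV[R]_#|S|, Khat *m v0 = y ->
  forall i : 'I_n,
    `|z i 0| = \big[Num.max/0]_(j < n) `|z j 0|
    <-> exists v : 'cV[R]_#|S|, v \in <[v0]>%VS /\ col i A = Khat *m v.
Proof.
move=> B S Khat A That J z zmin v0 Kv0 i.
have pM := posdef_gram_add A hC; set M := _ + C in pM.
have pM' := posdef_invmx pM.
have A_neq0 j : col j A != 0 by have [k ->] := col_reorder_cols S B j.
have d_gt0 j : 0 < bform (invmx M) (col j A) (col j A).
  exact: posdef_bform_gt0.
pose t : 'rV[R]_n := \row_j Num.sqrt (bform (invmx M) (col j A) (col j A)).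
have t_gt0 j : 0 < t 0 j by rewrite mxE sqrtr_gt0.
have ThatE : That = diag_mx t.
  rewrite /That /Diag sqrtmx_diag => [|j]; last by rewrite mxE bform_col.
  by congr diag_mx; apply/rowP=> j; rewrite mxE [in LHS]mxE bform_col mxE.
have uT : That \in unitmx by rewrite ThatE; exact/posdef_unitmx/posdef_diag.
have JE z' : J z' = tikhonov A C y (That *m z').
  rewrite /J (mahalanobis_sqr _ _ hC) (mahalanobis_sqr _ _ (posdef1 R n)).
  rewrite /tikhonov mulmxA invmx1 sub0r -[- (That *m z')]scaleN1r bformZl bformZr.
  by rewrite mulrA mulrNN !mul1r.
have Tz : That *m z = A^T *m invmx M *m y.
  (* As [That] is invertible, every competitor [x'] has the form [That *m z'], so optimality of [z]
     passes to [That *m z]. *)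
  apply: tikhonov_min => // x'; rewrite -(mulKVmx uT x') -!JE; exact: zmin.
have tz j : t 0 j * z j 0 = bform (invmx M) (col j A) y.
  by rewrite -bform_col_l -Tz ThatE mul_diag_mx mxE.
have tzsq j : bform (invmx M) (col j A) (col j A) * z j 0 ^+ 2 =
    bform (invmx M) (col j A) y ^+ 2.
  by rewrite -tz exprMn mxE sqr_sqrtr // ltW.
have z_le j : z j 0 ^+ 2 <= bform (invmx M) y y.
  by rewrite -(ler_pM2l (d_gt0 j)) tzsq CauchySchwarz_bform.
have z_eq j : z j 0 ^+ 2 = bform (invmx M) y y <-> exists c, col j A = c *: y.
  rewrite -(CauchySchwarz_bform_eq _ pM' hy) -tzsq.
  by split=> [->//|/(mulfI (lt0r_neq0 (d_gt0 j)))].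
have [k kS] : exists k, k \in S.
  by apply: (@cols_in_mul_neq0 _ _ _ _ B v0); rewrite -/Khat Kv0.
have [j0 j0E] := col_reorder_cols_in B kS.
have z_j0 : z j0 0 ^+ 2 = bform (invmx M) y y.
  apply/z_eq; rewrite j0E; apply: (proj_eq1_collinear hC hy (hcols k)).
  by move: kS; rewrite /S inE => /eqP.
(* The index [j0] attains the bound [z_le]; the initial value 0 of the maximum is harmless because
   absolute values are nonnegative. *)
have -> : \big[Num.max/0]_(j < n) `|z j 0| = `|z j0 0|.
  apply/le_anti/andP; split; last exact: (le_bigmax _ (fun j => `|z j 0|)).
  apply: bigmax_le => // j _.
  by rewrite -ler_sqr ?nnegrE // !real_normK ?num_real // z_j0.
have -> : `|z i 0| = `|z j0 0| <-> z i 0 ^+ 2 = bform (invmx M) y y.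
  rewrite -z_j0; split=> e; last by rewrite -!sqrtr_sqr e.
  by rewrite -(real_normK (num_real (z i 0))) e real_normK ?num_real.
(* [Khat] sends [c *: v0] to [c *: y], so the image of the line through [v0] is exactly the set of
   multiples of [y]. *)
rewrite z_eq; split=> [[c Ai]|[v [/vlineP[c ->] ->]]].
  by exists (c *: v0); rewrite memvZ ?memv_line // -scalemxAr Kv0.
by exists c; rewrite -scalemxAr Kv0.
Qed.
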